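(* Let $d=2$, let $r>0$, and let $\mathscr{U}_r:=\mathrm{int}\,\mathscr{K}_r^{co}$ be the interior of the convex hull of $\mathscr{K}_r$ in $\mathbb{R}^2\times\mathcal{S}^2_0$. Then $\mathscr{U}_r$ does not have the Perturbation Property (P).
   Context: $\mathcal{S}^d_0$ denotes the space of symmetric trace-free real $d\times d$ matrices. For $r>0$, $$\mathscr{K}_r=\{(v,u)\in\mathbb{R}^d\times\mathcal{S}^d_0: u=v\otimes v-\tfrac{r}{d}\mathrm{Id}\},$$ and $\mathscr{K}_r^{co}$ is its convex hull. Let $Q=(0,1)^d$. A pair $w=(v,u)\in C_c^\infty(Q;\mathbb{R}^d\times\mathcal{S}^d_0)$ is a (stationary) subsolution with associated pressure $q$ if $\mathrm{div}\,u+\nabla q=0$ and $\mathrm{div}\,v=0$ in $Q$. Perturbation Property (P) of a set $\mathscr{U}_r\subset\mathscr{K}_r^{co}$: there is a continuous strictly increasing function $\Phi:[0,\infty)\to[0,\infty)$ with $\Phi(0)=0$ such that for every $\bar w=(\bar v,\bar u)\in\mathscr{U}_r$ there exists a subsolution $w=(v,u)\in C_c^\infty(Q;\mathbb{R}^d\times\mathcal{S}^d_0)$ with associated pressure $q\in C_c^\infty(Q)$ such that (1) $\bar w+w(x)\in\mathscr{U}_r$ for all $x\in Q$; (2) $\int_Q|w(x)|^2\,dx\geq\Phi(\mathrm{dist}(\bar w,\mathscr{K}_r))$. Here $|(v,u)|^2=|v|^2+|u|^2$ with $|u|$ the operator norm, and $\mathrm{dist}$ is the corresponding distance (the choice of norm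 is immaterial). *)

(* Defs.v *)
From HB Require Import structures.
From mathcomp Require Import all_boot all_order all_algebra.
From mathcomp Require Import all_classical all_reals all_analysis measurable_realfun.

Set Implicit Arguments.
Unset Strict Implicit.
Unset Printing Implicit Defensive.

Import Order.TTheory GRing.Theory Num.Theory.
Import numFieldNormedType.Exports.

Local Open Scope classical_set_scope.
Local Open Scope ring_scope.

Section PhaseSpace.
Context {R : realType} {d : nat}.

(* Vectors of R^d are row vectors, so v (x) v is v^T *m v, and the action of a
   matrix u on x is x *m u^T.  R^d x S^d_0 is the subset phase_space of the
   normed module 'rV_d * 'M_d. *)

Definition sym_tracefree : set 'M[R]_d := [set u | u^T = u /\ \tr u = 0].

Definition phase_space : set ('rV[R]_d * 'M[R]_d) :=
  [set w | sym_tracefree w.2].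

Definition Kset (r : R) : set ('rV[R]_d * 'M[R]_d) :=
  [set w | phase_space w /\ w.2 = w.1^T *m w.1 - (r / d%:R)%:M].

Definition convex_hull (V : lmodType R) (A : set V) : set V :=
  \bigcap_(C in [set C : set V | convex_set C /\ A `<=` C]) C.

(* The interior is relative to R^d x S^d_0: it would be empty in 'rV_d * 'M_d. *)
Definition Uset (r : R) : set ('rV[R]_d * 'M[R]_d) :=
  (convex_hull (Kset r) : set (subspace phase_space))°.

Definition enorm (v : 'rV[R]_d) : R := Num.sqrt (\sum_i v 0 i ^+ 2).

Definition opnorm (u : 'M[R]_d) : R :=
  sup [set enorm (x *m u^T) | x in [set x | enorm x <= 1]].

Definition pnorm (w : 'rV[R]_d * 'M[R]_d) : R :=
  Num.sqrt (enorm w.1 ^+ 2 + opnorm w.2 ^+ 2).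

Definition dist (w : 'rV[R]_d * 'M[R]_d) (A : set ('rV[R]_d * 'M[R]_d)) : R :=
  inf [set pnorm (w - a) | a in A].

End PhaseSpace.

Section Subsolutions.
Context {R : realType} {d : nat}.

Definition unit_cube : set 'rV[R]_d := [set x | forall i, 0 < x 0 i < 1].

Definition partial (V : normedModType R) (i : 'I_d) (f : 'rV[R]_d -> V) :
    'rV[R]_d -> V :=
  fun x => 'D_(delta_mx 0 i) f x.

Definition smooth (V : normedModType R) (f : 'rV[R]_d -> V) : Prop :=
  forall s : seq 'I_d,
    let g := foldr (@partial V) f s in
    continuous g /\ forall i x, derivable g x (delta_mx 0 i).

(* A function on the open set Q is identified with its extension by zero. *)
Definition Cc_infty (Q : set 'rV[R]_d) (V : normedModType R)
    (f : 'rV[R]_d -> V) : Prop :=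
  let supp := closure [set x | f x <> 0] in
  [/\ smooth f, compact supp & supp `<=` Q].

Definition div_vec (v : 'rV[R]_d -> 'rV[R]_d) (x : 'rV[R]_d) : R :=
  \sum_i partial i (fun y => v y 0 i) x.

Definition div_mx (u : 'rV[R]_d -> 'M[R]_d) (x : 'rV[R]_d) : 'rV[R]_d :=
  \row_i \sum_j partial j (fun y => u y i j) x.

Definition grad (q : 'rV[R]_d -> R) (x : 'rV[R]_d) : 'rV[R]_d :=
  \row_i partial i q x.

Definition subsolution (w : 'rV[R]_d -> 'rV[R]_d * 'M[R]_d)
    (q : 'rV[R]_d -> R) : Prop :=
  [/\ Cc_infty unit_cube w,
      forall x, phase_space (w x),
      forall x, unit_cube x -> div_mx (fun y => (w y).2) x + grad q x = 0 &
      forall x, unit_cube x -> div_vec (fun y => (w y).1) x = 0].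

End Subsolutions.

Section Planar.
Context {R : realType}.

Definition vec2 (z : R * R) : 'rV[R]_2 :=
  \row_(i < 2) (if i == 0 then z.1 else z.2).

(* Integral over D with respect to two-dimensional Lebesgue measure. *)
Definition integral2 (D : set 'rV[R]_2) (f : 'rV[R]_2 -> R) : \bar R :=
  (\int[(@lebesgue_measure R) \x (@lebesgue_measure R)]_(z in vec2 @^-1` D)
     (f (vec2 z))%:E)%E.

Definition perturbation_property (r : R) (U : set ('rV[R]_2 * 'M[R]_2)) :
    Prop :=
  exists Phi : R -> R,
    [/\ {within `[0, +oo[, continuous Phi},
        {in `[0, +oo[ &, {homo Phi : s t / s < t}},
        Phi 0 = 0 &
        forall wbar, U wbar ->
          exists w q,
            [/\ subsolution w q,
                Cc_infty unit_cube q,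
                forall x, unit_cube x -> U (wbar + w x) &
                ((Phi (dist wbar (Kset r)))%:E <=
                 integral2 unit_cube (fun x => (pnorm (w x) ^+ 2)%R))%E]].

End Planar.

(* Main.v *)
Require Import Defs.
From mathcomp Require Import all_boot all_order all_algebra.
From mathcomp Require Import all_classical all_reals all_analysis measurable_realfun.
From mathcomp Require Import ring lra.

(** Write v = (x, y), u = [[a, b], [b, -a]] and r = 4 eta^2. Every state of the
    hull satisfies (v.e)^2 - <u e, e> <= (r / 2) |e|^2 for all e. The point
    (v, u) = ((0, eta), diag(eta^2, -eta^2)) lies on the boundary of the hull, at
    distance at least eta from K_r, and is the limit as t -> 1 of its multiples by
    t < 1, which are interior. For a perturbation of such a multiple, the vertical
    inequality e = (0, 1) has a nonnegative gap whose integral, together with that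
    of y^2, is a number delta which tends to 0, because the perturbation has zero
    mean; the inequalities for the nearby e say that b - x (t eta + y) is
    controlled by the square root of the gap. Hence t eta int x^2 is close to
    int x b, and since v and the rows of u + q Id are compactly supported and
    divergence free, the null Lagrangians give int x b = int y (a + q) and
    int q^2 = int (a^2 + b^2). So int x b is small with int y^2, all of w is small
    in L^2, and Phi(eta) <= 0 in the limit. *)

Set Implicit Arguments.
Unset Strict Implicit.
Unset Printing Implicit Defensive.

Import Order.TTheory GRing.Theory Num.Theory.
Import numFieldNormedType.Exports.

Local Open Scope classical_set_scope.
Local Open Scope ring_scope.

(** * Integrals over rectangles *)

Section PlaneIntegrals.
Context {R : realType}.
Notation mu := (@lebesgue_measure R).
Notation mu2 := (mu \x mu)%E.

(** Measurability in the plane refers to the product sigma-algebra, so an open set is written as the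
    countable union of the rational boxes it contains. *)
Lemma open_measurable_plane (A : set (R * R)) : open A -> measurable A.
Proof.
move=> oA.
pose B (q : (rat * rat) * (rat * rat)) : set (R * R) :=
  `](ratr q.1.1), (ratr q.1.2)[ `*` `](ratr q.2.1), (ratr q.2.2)[.
have -> : A = \bigcup_q (if `[< B q `<=` A >] then B q else set0).
  apply/seteqP; split => [z Az|z [q _]]; last by case: asboolP => // BA /BA.
  have /nbhs_ballP[e /= e0 eA] : nbhs z A by apply: open_nbhs_nbhs; split.
  have rat_itv (x : R) : exists p : rat * rat,
      [/\ x - e < ratr p.1, ratr p.1 < x, x < ratr p.2 & ratr p.2 < x + e].
    have /rat_in_itvoo[p] : x - e < x by rewrite ltrBlDr ltrDl.
    have /rat_in_itvoo[q] : x < x + e by rewrite ltrDl.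
    rewrite !in_itv/= => /andP[q1 q2] /andP[p1 p2].
    by exists (p, q).
  have [[p1 p2]/= [p3 p4 p5 p6]] := rat_itv z.1.
  have [[q1 q2]/= [q3 q4 q5 q6]] := rat_itv z.2.
  exists ((p1, p2), (q1, q2)) => //.
  case: asboolP => [_|nBA]; first by split; rewrite /= in_itv/= ?p4 ?q4.
  exfalso; apply: nBA => y [/= y1 y2]; apply: eA.
  move: y1 y2; rewrite !in_itv/= => /andP[? ?] /andP[? ?].
  by split; rewrite /ball/= ltr_norml; lra.
apply: countable_bigcupT_measurable => [|q]; first exact: countableP.
by case: ifP => // _; apply: measurableX; exact: measurable_itv.
Qed.

Lemma continuous_measurable_plane (f : R * R -> R) :
  continuous f -> measurable_fun setT f.
Proof.
move=> /continuousP cf; apply: (measurability _ (RGenOpens.measurableE R)).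
move=> _ [_ [a [b ->] <-]]; rewrite setTI; apply: open_measurable_plane.
exact/cf/interval_open.
Qed.

Lemma continuous_sliceR (f : R * R -> R) x :
  continuous f -> continuous (fun y => f (x, y)).
Proof.
move=> cf y; apply: (@continuous_comp _ _ _ (fun y => (x, y))); last exact: cf.
apply: (@cvg_pair _ _ _ _ (nbhs x) (nbhs y)); [exact: cvg_cst|exact: cvg_id].
Qed.

Lemma continuous_sliceL (f : R * R -> R) y :
  continuous f -> continuous (fun x => f (x, y)).
Proof.
move=> cf x; apply: (@continuous_comp _ _ _ (fun x => (x, y))); last exact: cf.
apply: (@cvg_pair _ _ _ _ (nbhs x) (nbhs y)); [exact: cvg_id|exact: cvg_cst].
Qed.

Lemma mu_itv_lty (a b : R) : (mu `[a, b] < +oo)%E.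
Proof.
by rewrite lebesgue_measure_itv/=; case: ifP => // _; rewrite -EFinB ltry.
Qed.

Lemma continuous_integrable_itv (f : R -> R) (a b : R) :
  continuous f -> mu.-integrable `[a, b] (EFin \o f).
Proof.
move=> cf; apply: continuous_compact_integrable; first exact: segment_compact.
exact: continuous_subspaceT.
Qed.

Definition rect (a b c d : R) : set (R * R) := `[a, b] `*` `[c, d].

Lemma measurable_rect a b c d : measurable (rect a b c d).
Proof. by apply: measurableX; exact: measurable_itv. Qed.

Lemma rect_bounded a b c d (f : R * R -> R) : continuous f ->
  exists M, forall z, rect a b c d z -> `|f z| <= M.
Proof.
move=> cf; have : compact (f @` rect a b c d).
  apply: continuous_compact; first exact: continuous_subspaceT.
  by apply: compact_setX; exact: segment_compact.
move=> /compact_bounded[M [_ /(_ (M + 1))]]; rewrite ltrDl ltr01 => /(_ isT) h.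
by exists (M + 1) => z rz; apply: h; exists z.
Qed.

Lemma continuous_integrable_rect (f : R * R -> R) a b c d :
  continuous f -> mu2.-integrable (rect a b c d) (EFin \o f).
Proof.
move=> cf; have mr := measurable_rect a b c d.
apply: measurable_bounded_integrable => //.
- rewrite [ltLHS]product_measure1E//; try exact: measurable_itv.
  by rewrite lte_mul_pinfty// ?mu_itv_lty// ge0_fin_numE// mu_itv_lty.
- apply: (@measurable_funS _ _ _ _ setT) => //.
  exact: continuous_measurable_plane.
- have [M hM] := rect_bounded a b c d cf.
  exists M; split; first exact: num_real.
  by move=> x Mx z /hM /le_trans; apply; exact: ltW.
Qed.

(** Fubini for the extension of [f] by zero; the slices of [f] are continuous, so the inner
    integrals are finite and [fine] loses nothing. *)
Lemma Rintegral_rect12 (f : R * R -> R) a b c d : continuous f ->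
  \int[mu2]_(z in rect a b c d) f z =
  \int[mu]_(x in `[a, b]) \int[mu]_(y in `[c, d]) f (x, y).
Proof.
move=> cf.
have mr := measurable_rect a b c d.
have intf : mu2.-integrable setT (EFin \o (f \_ (rect a b c d))).
  rewrite -restrict_EFin; apply/integrable_restrict => //=; rewrite setTI.
  exact: continuous_integrable_rect.
have cfx x : continuous (fun y => f (x, y)).
  exact: continuous_sliceR.
rewrite Rintegral_mkcond [RHS]Rintegral_mkcond /Rintegral.
congr fine.
rewrite -(@integral12_prod_meas1 _ _ _ _ _ mu mu (EFin \o (f \_ (rect a b c d))))//.
apply: eq_integral => x _ /=.
rewrite /fubini_F/= patchE; case: ifPn => xab; last first.
  rewrite integral0_eq// => y _; rewrite patchE ifF//.
  by apply: contraNF xab; rewrite !inE => -[].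
rewrite fineK; last first.
  by apply: integrable_fin_num => //; exact: continuous_integrable_itv.
rewrite [RHS]integral_mkcond; apply: eq_integral => y _.
rewrite !patchE.
have -> : ((x, y) \in rect a b c d) = (y \in `[c, d]%classic).
  apply/idP/idP; rewrite !inE; first by move=> -[].
  by move: xab; rewrite inE; split.
by case: ifP.
Qed.

Lemma Rintegral_rect21 (f : R * R -> R) a b c d : continuous f ->
  \int[mu2]_(z in rect a b c d) f z =
  \int[mu]_(y in `[c, d]) \int[mu]_(x in `[a, b]) f (x, y).
Proof.
move=> cf.
have mr := measurable_rect a b c d.
have intf : mu2.-integrable setT (EFin \o (f \_ (rect a b c d))).
  rewrite -restrict_EFin; apply/integrable_restrict => //=; rewrite setTI.
  exact: continuous_integrable_rect.
have cfx y : continuous (fun x => f (x, y)).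
  exact: continuous_sliceL.
rewrite Rintegral_mkcond [RHS]Rintegral_mkcond /Rintegral.
congr fine.
rewrite -(@integral21_prod_meas1 _ _ _ _ _ mu mu (EFin \o (f \_ (rect a b c d))))//.
apply: eq_integral => y _ /=.
rewrite /fubini_G/= patchE; case: ifPn => ycd; last first.
  rewrite integral0_eq// => x _; rewrite patchE ifF//.
  by apply: contraNF ycd; rewrite !inE => -[].
rewrite fineK; last first.
  by apply: integrable_fin_num => //; exact: continuous_integrable_itv.
rewrite [RHS]integral_mkcond; apply: eq_integral => x _.
rewrite !patchE.
have -> : ((x, y) \in rect a b c d) = (x \in `[a, b]%classic).
  apply/idP/idP; rewrite !inE; first by move=> -[].
  by move: ycd; rewrite inE; split.
by case: ifP.
Qed.

End PlaneIntegrals.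

(** * Divergence-free fields and null Lagrangians *)

Section NullLagrangian.
Context {R : realType}.
Notation mu := (@lebesgue_measure R).
Notation mu2 := (mu \x mu)%E.
Implicit Types f g : R * R -> R.

Lemma Rintegral_derive (F f : R -> R) (a b : R) : a <= b -> continuous f ->
  (forall x : R, is_derive x 1 F (f x)) ->
  \int[mu]_(x in `[a, b]) f x = F b - F a.
Proof.
rewrite le_eqVlt => /predU1P[<- _ _|ab cf dF].
  by rewrite set_itv1 Rintegral_set1 subrr.
have cF x : {for x, continuous F}.
  by apply/differentiable_continuous/derivable1_diffP; case: (dF x).
rewrite /Rintegral (@continuous_FTC2 _ _ F)//.
- exact: continuous_subspaceT.
- split=> [x _||]; first by case: (dF x).
  + exact/cvg_at_right_filter/cF.
  + exact/cvg_at_left_filter/cF.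
- by move=> x _; rewrite derive1E; apply: derive_val.
Qed.

(** The partial derivatives are explicit data, taken along coordinate lines, so that one-variable
    calculus applies to each slice. *)
Definition C1 f f1 f2 := [/\ continuous f, continuous f1, continuous f2,
  forall s t : R, is_derive s 1 (fun s => f (s, t)) (f1 (s, t)) &
  forall s t : R, is_derive t 1 (fun t => f (s, t)) (f2 (s, t))].

Definition vanish_off_square f :=
  forall s t, ~ ((0 < s < 1) && (0 < t < 1)) -> f (s, t) = 0.

Lemma C1_cst c : C1 (cst c) (cst 0) (cst 0).
Proof. by split => *; try exact: cst_continuous; apply: is_derive_cst. Qed.

Lemma C1N f f1 f2 : C1 f f1 f2 -> C1 (- f) (- f1) (- f2).
Proof.
move=> [cf cf1 cf2 d1 d2]; split.
- by move=> z; apply: continuousN; exact: cf.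
- by move=> z; apply: continuousN; exact: cf1.
- by move=> z; apply: continuousN; exact: cf2.
- by move=> s t; apply: is_deriveN.
- by move=> s t; apply: is_deriveN.
Qed.

Lemma C1D f f1 f2 g g1 g2 : C1 f f1 f2 -> C1 g g1 g2 ->
  C1 (f + g) (f1 + g1) (f2 + g2).
Proof.
move=> [cf cf1 cf2 d1 d2] [cg cg1 cg2 e1 e2]; split.
- by move=> z; apply: continuousD; [exact: cf|exact: cg].
- by move=> z; apply: continuousD; [exact: cf1|exact: cg1].
- by move=> z; apply: continuousD; [exact: cf2|exact: cg2].
- by move=> s t; apply: is_deriveD.
- by move=> s t; apply: is_deriveD.
Qed.

Lemma C1M f f1 f2 g g1 g2 : C1 f f1 f2 -> C1 g g1 g2 ->
  C1 (f * g) (f1 * g + f * g1) (f2 * g + f * g2).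
Proof.
move=> [cf cf1 cf2 d1 d2] [cg cg1 cg2 e1 e2].
have cM (u v : R * R -> R) : continuous u -> continuous v -> continuous (u * v).
  by move=> cu cv z; apply: continuousM; [exact: cu|exact: cv].
have cD (u v : R * R -> R) : continuous u -> continuous v -> continuous (u + v).
  by move=> cu cv z; apply: continuousD; [exact: cu|exact: cv].
split; [exact: cM|by apply: cD; exact: cM|by apply: cD; exact: cM| |].
- move=> s t; apply: (is_derive_eq (is_deriveM (d1 s t) (e1 s t))).
  by rewrite /GRing.scale/= addrC mulrC.
- move=> s t; apply: (is_derive_eq (is_deriveM (d2 s t) (e2 s t))).
  by rewrite /GRing.scale/= addrC mulrC.
Qed.

Lemma vanish_bounded f : continuous f -> vanish_off_square f ->
  exists M, forall z, `|f z| <= M.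
Proof.
move=> cf vf; have [M hM] := rect_bounded 0 1 0 1 cf.
exists (Num.max M 0) => -[s t].
have [st|/negP st] := boolP ((0 < s < 1) && (0 < t < 1)); last first.
  by rewrite vf// normr0 le_max lexx orbT.
rewrite le_max hM//; case/andP: st => /andP[? ?] /andP[? ?].
by split; rewrite /= in_itv/=; apply/andP; split; exact: ltW.
Qed.

(** By Fubini the differentiated variable is integrated first, and the boundary values given by the
    fundamental theorem vanish. *)
Lemma integral_partial_eq0 f f1 f2 : C1 f f1 f2 -> vanish_off_square f ->
  \int[mu2]_(z in rect 0 1 0 1) f1 z = 0 /\
  \int[mu2]_(z in rect 0 1 0 1) f2 z = 0.
Proof.
move=> [cf cf1 cf2 d1 d2] vf.
rewrite Rintegral_rect21// Rintegral_rect12//; split.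
- rewrite (@eq_Rintegral _ _ _ mu _ (cst 0)) ?Rintegral_cst ?mul0r//.
  move=> t _; rewrite (@Rintegral_derive (fun s => f (s, t)))//.
    by rewrite !vf ?subrr// ltxx /= ?andbF.
  exact: continuous_sliceL.
- rewrite (@eq_Rintegral _ _ _ mu _ (cst 0)) ?Rintegral_cst ?mul0r//.
  move=> s _; rewrite (@Rintegral_derive (fun t => f (s, t)))//.
    by rewrite !vf ?subrr// ltxx /= ?andbF.
  exact: continuous_sliceR.
Qed.


(** Each slice is [M]-Lipschitz by the mean value theorem, and two coordinate steps join any two
    points. This gives joint continuity to a potential known only through its partial
    derivatives. *)
Lemma C1_bounded_continuous (f f1 f2 : R * R -> R) (M : R) :
  (forall s t : R, is_derive s 1 (fun s => f (s, t)) (f1 (s, t))) ->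
  (forall s t : R, is_derive t 1 (fun t => f (s, t)) (f2 (s, t))) ->
  (forall z, `|f1 z| <= M) -> (forall z, `|f2 z| <= M) -> continuous f.
Proof.
move=> d1 d2 M1 M2.
have M0 : 0 <= M by exact: le_trans (M1 (0, 0)).
have lip (F f' : R -> R) : (forall x : R, is_derive x 1 F (f' x)) ->
    (forall x, `|f' x| <= M) -> forall x y, `|F x - F y| <= M * `|x - y|.
  move=> dF Mf' x y; wlog xy : x y / y <= x.
    move=> h; have [/h//|/ltW/h] := leP y x.
    by rewrite distrC [in X in _ -> _ <= X]distrC.
  have cF : continuous F.
    by move=> z; apply/differentiable_continuous/derivable1_diffP; case: (dF z).
  have [c _ ->] : exists2 c, c \in `[y, x]%R & F x - F y = f' c * (x - y).
    apply: MVT_segment => //.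
    exact: continuous_subspaceT.
  by rewrite normrM ler_wpM2r.
move=> [s0 t0]; apply/cvgrPdist_le => /= e e0.
pose d := e / (2 * (M + 1)).
have d0 : 0 < d by rewrite divr_gt0// mulr_gt0// ltr_wpDl.
exists (ball s0 d, ball t0 d) => /=; first by split; exact: nbhsx_ballx.
move=> [s t] [/= sd td].
have -> : f (s0, t0) - f (s, t) = (f (s0, t0) - f (s, t0)) + (f (s, t0) - f (s, t)).
  by rewrite addrA subrK.
have h1 := lip _ _ (d1^~ t0) (fun x => M1 (x, t0)) s0 s.
have h2 := lip _ _ (d2 s) (fun x => M2 (s, x)) t0 t.
have Md : M * d <= e / 2.
  rewrite /d mulrA ler_pdivrMr; last by rewrite mulr_gt0// ltr_wpDl.
  nra.
rewrite (le_trans (ler_normD _ _))//; rewrite [e]splitr; apply: lerD.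
- by rewrite (le_trans h1)// (le_trans _ Md)// ler_wpM2l// ltW.
- by rewrite (le_trans h2)// (le_trans _ Md)// ler_wpM2l// ltW.
Qed.

(** For [x < 0] the integral is locally zero; for [x >= 0] the point is interior to an interval
    starting at -1 and the fundamental theorem applies. *)
Lemma is_derive_Rintegral (g : R -> R) : continuous g ->
  (forall x, x <= 0 -> g x = 0) ->
  forall x : R, is_derive x 1 (fun y => \int[mu]_(z in `[-1, y]) g z) (g x).
Proof.
move=> cg g0 x; have [x0|x0] := ltP x 0.
  rewrite g0 ?ltW//.
  apply: (@near_eq_is_derive _ _ _ (cst 0)).
  near=> y.
  rewrite (@eq_Rintegral _ _ _ mu _ (cst 0)) ?Rintegral_cst ?mul0r// => z.
  rewrite inE/= in_itv/= => /andP[_ zy]; apply: g0.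
  by rewrite (le_trans zy)//; near: y; apply: (cvgr_le x) x0; exact: cvg_id.
have [] := @continuous_FTC1_closed _ g (-1) x (x + 1).
- by rewrite ltrDl.
- exact: continuous_integrable_itv.
- by rewrite (lt_le_trans _ x0)// ltrN10.
- exact: cg.
- by move=> dF F'; exact: (DeriveDef dF (etrans (esym (derive1E _ _)) F')).
Unshelve. all: by end_near. Qed.

(* Integrating from -1 rather than 0 keeps the base point away from the support,
   so that the potential is differentiable on the whole plane. *)
Lemma closed_form_potential f f1 f2 g g1 g2 :
  C1 f f1 f2 -> C1 g g1 g2 -> f2 =1 g1 ->
  vanish_off_square f -> vanish_off_square g ->
  exists psi, C1 psi f g /\ vanish_off_square psi.
Proof.
move=> [cf cf1 cf2 df1 df2] [cg cg1 cg2 dg1 dg2] fg vf vg.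
pose psi (z : R * R) := \int[mu]_(x in `[-1, z.1]) f (x, z.2).
have integral0 (h : R -> R) (a : R) : (forall x, x <= a -> h x = 0) ->
    \int[mu]_(x in `[-1, a]) h x = 0.
  move=> h0; rewrite (@eq_Rintegral _ _ _ mu _ (cst 0)) ?Rintegral_cst ?mul0r//.
  by move=> x; rewrite inE/= in_itv/= => /andP[_ /h0].
have out (s t : R) : s <= 0 \/ 1 <= s \/ t <= 0 \/ 1 <= t ->
    ~ ((0 < s < 1) && (0 < t < 1)).
  by move=> h /andP[/andP[? ?] /andP[? ?]]; lra.
(* Integrating [g] vertically gives the same potential: both expressions are the integral of
   [f2 = g1] over the rectangle with corners (-1, -1) and (s, t). *)
have psiE s t : psi (s, t) = \int[mu]_(y in `[-1, t]) g (s, y).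
  have [s1|s1] := ltP s (-1).
    by rewrite /psi/= !integral0// => x xs; [apply: vg|apply: vf]; apply: out; lra.
  have [t1|t1] := ltP t (-1).
    by rewrite /psi/= !integral0// => x xs; [apply: vg|apply: vf]; apply: out; lra.
  transitivity (\int[mu]_(x in `[-1, s]) \int[mu]_(y in `[-1, t]) f2 (x, y)).
    apply: eq_Rintegral => x _; rewrite (@Rintegral_derive (fun t => f (x, t)))//.
      by rewrite (vf x (-1)) ?subr0//; apply: out; lra.
    exact: continuous_sliceR.
  rewrite -Rintegral_rect12// Rintegral_rect21//.
  apply: eq_Rintegral => y _.
  rewrite (funext fg) (@Rintegral_derive (fun s => g (s, y)))//.
    by rewrite (vg (-1) y) ?subr0//; apply: out; lra.
  exact: continuous_sliceL.
have d1 (s t : R) : is_derive s 1 (fun s => psi (s, t)) (f (s, t)).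
  apply: (is_derive_Rintegral (g := fun x => f (x, t))).
    exact: continuous_sliceL.
  by move=> x x0; apply/vf/out; lra.
have d2 (s t : R) : is_derive t 1 (fun t => psi (s, t)) (g (s, t)).
  rewrite (funext (psiE s)).
  apply: (is_derive_Rintegral (g := fun x => g (s, x))).
    exact: continuous_sliceR.
  by move=> x x0; apply/vg/out; lra.
exists psi; split.
  have [M1 hM1] := vanish_bounded cf vf; have [M2 hM2] := vanish_bounded cg vg.
  split => //; apply: (C1_bounded_continuous (M := Num.max M1 M2) d1 d2) => z.
    by rewrite le_max hM1.
  by rewrite le_max hM2 orbT.
move=> s t st.
(* Left of the square the range of integration of [f] misses the support, and above the square [f]
   vanishes on the whole line; the bottom and right sides are treated alike through [psiE]. *)
have [s0|s0] := leP s 0.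
  by rewrite /psi/= integral0// => x xs; apply/vf/out; lra.
have [t0|t0] := leP t 0.
  by rewrite psiE integral0// => x xs; apply/vg/out; lra.
have [t1|t1] := leP 1 t.
  rewrite /psi/= (@eq_Rintegral _ _ _ mu _ (cst 0)) ?Rintegral_cst ?mul0r// => x _.
  by apply/vf/out; lra.
have [s1|s1] := leP 1 s.
  rewrite psiE (@eq_Rintegral _ _ _ mu _ (cst 0)) ?Rintegral_cst ?mul0r// => x _.
  by apply/vg/out; lra.
by exfalso; apply: st; rewrite s0 s1 t0 t1.
Qed.

(* If a = d_2 psi and b = - d_1 psi, the integrand is
   d_1 (psi * c) + d_2 (psi * d). *)
Lemma integral_cross_eq0 a a1 a2 b b1 b2 c c1 c2 d d1 d2 :
  C1 a a1 a2 -> C1 b b1 b2 -> a1 + b2 = 0 ->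
  vanish_off_square a -> vanish_off_square b ->
  C1 c c1 c2 -> C1 d d1 d2 -> c1 + d2 = 0 ->
  \int[mu2]_(z in rect 0 1 0 1) (a z * d z - b z * c z) = 0.
Proof.
move=> Ca Cb ab va vb Cc Cd cd.
have ba : - b2 =1 a1.
  by move=> z; apply/esym/eqP; rewrite -addr_eq0 -[_ + _]/((a1 + b2) z) ab.
have vNb : vanish_off_square (- b).
  by move=> s t st; rewrite -[LHS]/(- b (s, t)) vb// oppr0.
have [psi [Cpsi vpsi]] := closed_form_potential (C1N Cb) Ca ba vNb va.
have vM (u : R * R -> R) : vanish_off_square (psi * u).
  by move=> s t st; rewrite -[LHS]/(psi (s, t) * u (s, t)) vpsi// mul0r.
have [I1 _] := integral_partial_eq0 (C1M Cpsi Cc) (vM c).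
have [_ I2] := integral_partial_eq0 (C1M Cpsi Cd) (vM d).
rewrite -[RHS]addr0 -[X in _ = X + _]I1 -[X in _ = _ + X]I2 -RintegralD;
  [|exact: measurable_rect| |].
- apply: eq_Rintegral => z _.
  have : c1 z + d2 z = 0 by rewrite -[LHS]/((c1 + d2) z) cd.
  move=> /eqP; rewrite addr_eq0 => /eqP cdz.
  rewrite -[(_ + _) z]/(- b z * c z + psi z * c1 z).
  rewrite -[X in _ = _ + X]/(a z * d z + psi z * d2 z) cdz; ring.
- by have [_ + _ _ _] := C1M Cpsi Cc; exact: continuous_integrable_rect.
- by have [_ _ + _ _] := C1M Cpsi Cd; exact: continuous_integrable_rect.
Qed.

End NullLagrangian.

(** * Functions on row vectors *)

Section Slices.
Context {R : realType}.
Notation mu := (@lebesgue_measure R).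
Notation mu2 := (mu \x mu)%E.

Lemma vec2E (z : R * R) :
  vec2 z = z.1 *: delta_mx 0 0 + z.2 *: delta_mx 0 1.
Proof.
apply/rowP => -[[|[|//]] i2]; rewrite !mxE/=.
  by rewrite mulr1 mulr0 addr0.
by rewrite mulr1 mulr0 add0r.
Qed.

Lemma vec2_continuous : continuous (@vec2 R).
Proof.
rewrite (funext vec2E) => z.
by apply: cvgD; apply: cvgZr_tmp; [exact: cvg_fst|exact: cvg_snd].
Qed.

Lemma unit_cube_vec2 (s t : R) :
  unit_cube (vec2 (s, t)) <-> (0 < s < 1) && (0 < t < 1).
Proof.
split=> [h|/andP[h0 h1] [[|[|//]] i2]]; last 2 first.
- by rewrite mxE.
- by rewrite mxE.
by have := h ord0; have := h (Ordinal (isT : 1 < 2)%N); rewrite !mxE/= => -> ->.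
Qed.

(** Continuity lets [l] pass through the limit of the difference quotients. Linearity is a plain
    hypothesis so that coordinate functions of a state can be used directly. *)
Lemma is_derive_linear (U V : normedModType R) (f : U -> V) (l : V -> R) x v :
  (forall k u u', l (k *: u + u') = k * l u + l u') -> continuous l ->
  derivable f x v -> is_derive x v (l \o f) (l ('D_v f x)).
Proof.
move=> ll cl df.
have l0 : l 0 = 0.
  by have := ll (-1) 0 0; rewrite scaler0 addr0 mulN1r addNr.
have lZ k u : l (k *: u) = k * l u by rewrite -[k *: u]addr0 ll l0 addr0.
have lB u u' : l (u - u') = l u - l u'.
  by rewrite addrC -scaleN1r ll mulN1r addrC.
have cv : (fun h => h^-1 *: (((l \o f) \o shift x) (h *: v) - (l \o f) x)) @ 0^'
    --> l ('D_v f x).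
  have -> : (fun h => h^-1 *: (((l \o f) \o shift x) (h *: v) - (l \o f) x)) =
      l \o (fun h => h^-1 *: ((f \o shift x) (h *: v) - f x)).
    by apply/funext => h /=; rewrite lZ lB.
  exact: (continuous_cvg _ (cl _) df).
by apply: DeriveDef; [apply/cvg_ex; eexists; exact: cv|exact/cvg_lim].
Qed.

Lemma is_derive_slice0 (g : 'rV[R]_2 -> R) (s t d : R) :
  is_derive (vec2 (s, t)) (delta_mx 0 0) g d ->
  is_derive s 1 (fun s => g (vec2 (s, t))) d.
Proof.
have e : (fun h => h^-1 *: (((fun s => g (vec2 (s, t))) \o shift s) (h *: 1)
      - g (vec2 (s, t)))) =
    (fun h : R => h^-1 *: ((g \o shift (vec2 (s, t))) (h *: delta_mx 0 0)
      - g (vec2 (s, t)))).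
  apply/funext => h /=; congr (_ *: (g _ - _)).
  by rewrite !vec2E/= addrA -scalerDl [h *: 1]mulr1.
by move=> [dg gd]; apply: DeriveDef; rewrite /derivable/derive e.
Qed.

Lemma is_derive_slice1 (g : 'rV[R]_2 -> R) (s t d : R) :
  is_derive (vec2 (s, t)) (delta_mx 0 1) g d ->
  is_derive t 1 (fun t => g (vec2 (s, t))) d.
Proof.
have e : (fun h => h^-1 *: (((fun t => g (vec2 (s, t))) \o shift t) (h *: 1)
      - g (vec2 (s, t)))) =
    (fun h : R => h^-1 *: ((g \o shift (vec2 (s, t))) (h *: delta_mx 0 1)
      - g (vec2 (s, t)))).
  apply/funext => h /=; congr (_ *: (g _ - _)).
  by rewrite !vec2E/= addrCA -scalerDl [h *: 1]mulr1.
by move=> [dg gd]; apply: DeriveDef; rewrite /derivable/derive e.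
Qed.

(** With [l] a coordinate functional, this turns each scalar component of a smooth field into a [C1]
    function on [R * R]. *)
Lemma C1_smooth (V : normedModType R) (f : 'rV[R]_2 -> V) (l : V -> R) :
  (forall k u u', l (k *: u + u') = k * l u + l u') -> continuous l ->
  smooth f ->
  C1 (l \o f \o vec2) (partial 0 (l \o f) \o vec2) (partial 1 (l \o f) \o vec2).
Proof.
move=> ll cl sf.
have [cf df] := sf [::].
have dl i x := is_derive_linear ll cl (df i x).
have pl i : partial i (l \o f) = l \o partial i f.
  by apply/funext => x; rewrite /partial/=; apply: derive_val.
have cc (g : 'rV[R]_2 -> V) : continuous g -> continuous (l \o g \o vec2).
  move=> cg z; apply: continuous_comp; first exact: vec2_continuous.
  by apply: continuous_comp; [exact: cg|exact: cl].
rewrite !pl; split.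
- exact: cc.
- by apply: cc; have [] := sf [:: 0].
- by apply: cc; have [] := sf [:: 1].
- by move=> s t; exact: is_derive_slice0.
- by move=> s t; exact: is_derive_slice1.
Qed.

(** A point outside [Q] lies in the open complement of the closed support. A whole neighbourhood is
    needed to make the derivatives vanish as well. *)
Lemma Cc_infty_eq0 (V : normedModType R) (Q : set 'rV[R]_2) (f : 'rV[R]_2 -> V) x :
  Cc_infty Q f -> ~ Q x -> \forall y \near x, f y = 0.
Proof.
move=> [_ _ sQ] Qx.
have : (~` closure [set x | f x <> 0]) x by move=> /sQ.
rewrite -interiorC => h; near=> y.
by apply: contrapT => fy; have : (~` [set x | f x <> 0]) y by near: y.
Unshelve. all: by end_near. Qed.

Lemma partial_eq0 (V : normedModType R) (f : 'rV[R]_2 -> V) x i :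
  (\forall y \near x, f y = 0) -> partial i f x = 0.
Proof.
move=> f0; rewrite /partial (@near_eq_derive _ _ _ _ (cst 0)) ?derive_cst//.
Qed.

End Slices.

(** * Integral identities for subsolutions *)

Section Subsolution.
Context {R : realType}.
Notation mu := (@lebesgue_measure R).
Notation mu2 := (mu \x mu)%E.
Notation state := ('rV[R]_2 * 'M[R]_2)%type.
Notation I f := (\int[mu2]_(z in rect 0 1 0 1) f z).

Lemma vcoord_linear i k (w w' : state) :
  (k *: w + w').1 0 i = k * w.1 0 i + w'.1 0 i.
Proof. by rewrite !mxE. Qed.

Lemma mcoord_linear i j k (w w' : state) :
  (k *: w + w').2 i j = k * w.2 i j + w'.2 i j.
Proof. by rewrite !mxE. Qed.

Lemma vcoord_continuous i : continuous (fun w : state => w.1 0 i).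
Proof.
move=> w; apply: (@continuous_comp _ _ _ fst (fun v : 'rV[R]_2 => v 0 i)).
  exact: cvg_fst.
exact: coord_continuous.
Qed.

Lemma mcoord_continuous i j : continuous (fun w : state => w.2 i j).
Proof.
move=> w; apply: (@continuous_comp _ _ _ snd (fun u : 'M[R]_2 => u i j)).
  exact: cvg_snd.
exact: coord_continuous.
Qed.

Lemma sum_ord2 (F : 'I_2 -> R) : \sum_i F i = F 0 + F 1.
Proof. by rewrite big_ord_recl big_ord1; congr (_ + F _); exact/val_inj. Qed.

Lemma phase_space2 (w : state) :
  phase_space w <-> w.2 1 0 = w.2 0 1 /\ w.2 1 1 = - w.2 0 0.
Proof.
split=> [[sy tr]|[h1 h2]].
  split; first by rewrite -[in LHS]sy mxE.
  by apply/eqP; rewrite -addr_eq0 addrC -(sum_ord2 (fun i => w.2 i i)); exact/eqP.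
split; last by rewrite /mxtrace sum_ord2 h2 subrr.
apply/matrixP => -[[|[|//]] i2] -[[|[|//]] j2]; rewrite !mxE;
  have e0 (k : (0 < 2)%N) : Ordinal k = 0 by exact/val_inj.
all: have e1 (k : (1 < 2)%N) : Ordinal k = 1 by exact/val_inj.
all: by rewrite ?e0 ?e1 ?h1.
Qed.

Variables (w : 'rV[R]_2 -> state) (q : 'rV[R]_2 -> R).
Hypotheses (wq : subsolution w q) (cq : Cc_infty unit_cube q).

Let x z : R := (w (vec2 z)).1 0 0.
Let y z : R := (w (vec2 z)).1 0 1.
Let a z : R := (w (vec2 z)).2 0 0.
Let b z : R := (w (vec2 z)).2 0 1.
Let p z := q (vec2 z).

Let smooth_w : smooth w. Proof. by have [[]] := wq. Qed.
Let smooth_q : smooth q. Proof. by have [] := cq. Qed.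

Lemma subsolution_vanish z : ~ unit_cube z -> w z = 0.
Proof.
move=> Qz; have [/Cc_infty_eq0 /(_ Qz) h _ _ _] := wq.
exact: nbhs_singleton h.
Qed.

Let C1v i := C1_smooth (vcoord_linear i) (vcoord_continuous (i:=i)) smooth_w.
Let C1m i j := C1_smooth (mcoord_linear i j) (@mcoord_continuous i j) smooth_w.
Let C1q : C1 (q \o vec2) (partial 0 q \o vec2) (partial 1 q \o vec2).
Proof.
have := @C1_smooth _ _ q id (fun _ _ _ => erefl) (fun _ => cvg_id) smooth_q.
exact.
Qed.

Let vanish_comp (l : state -> R) : l 0 = 0 -> vanish_off_square (l \o w \o vec2).
Proof.
by move=> l0 s t st /=; rewrite subsolution_vanish// => /unit_cube_vec2.
Qed.

Let vanish_q : vanish_off_square (q \o vec2).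
Proof.
move=> s t st.
have /(Cc_infty_eq0 cq) h : ~ unit_cube (vec2 (s, t)) by move/unit_cube_vec2.
exact: nbhs_singleton h.
Qed.

Let partial_vanish (l : state -> R) z i : l 0 = 0 -> ~ unit_cube z ->
  partial i (l \o w) z = 0.
Proof.
move=> l0 Qz; apply: partial_eq0; have [/Cc_infty_eq0 /(_ Qz) + _ _ _] := wq.
by apply: filterS => t /= ->.
Qed.

Let partial_v i j z : ~ unit_cube z -> partial j (fun t => (w t).1 0 i) z = 0.
Proof. by apply: (@partial_vanish (fun t => t.1 0 i)); rewrite mxE. Qed.

Let partial_m i k j z :
  ~ unit_cube z -> partial j (fun t => (w t).2 i k) z = 0.
Proof. by apply: (@partial_vanish (fun t => t.2 i k)); rewrite mxE. Qed.

(** The equations of a subsolution are assumed on the open cube only; outside it all derivatives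
    vanish, so they hold on the whole plane. *)
Let div_v : (partial 0 (fun t => (w t).1 0 0) \o vec2) +
  (partial 1 (fun t => (w t).1 0 1) \o vec2) = 0.
Proof.
apply/funext => z; rewrite -[LHS]/(_ (vec2 z) + _ (vec2 z)).
have [Qz|Qz] := pselect (unit_cube (vec2 z)).
  by have [_ _ _ /(_ _ Qz)] := wq; rewrite /div_vec sum_ord2.
by rewrite !partial_v// addr0.
Qed.

Let div_S i : (partial 0 (fun t => (w t).2 i 0) \o vec2) +
  (partial 1 (fun t => (w t).2 i 1) \o vec2) + (partial i q \o vec2) = 0.
Proof.
apply/funext => z; rewrite -[LHS]/(_ (vec2 z) + _ (vec2 z) + _ (vec2 z)).
have [Qz|Qz] := pselect (unit_cube (vec2 z)).
  by have [_ _ /(_ _ Qz)/rowP/(_ i) + _] := wq; rewrite !mxE sum_ord2.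
rewrite !partial_m// !add0r.
exact/partial_eq0/(Cc_infty_eq0 cq).
Qed.

Let Cx := C1v 0.
Let Cy := C1v 1.
(** The entries of S = u + q Id, whose rows are divergence free. *)
Let CS00 := C1D (C1m 0 0) C1q.
Let CS01 := C1m 0 1.
Let CS10 := C1m 1 0.
Let CS11 := C1D (C1m 1 1) C1q.

Let vx : vanish_off_square x.
Proof. by apply: (@vanish_comp (fun w => w.1 0 0)); rewrite mxE. Qed.
Let vy : vanish_off_square y.
Proof. by apply: (@vanish_comp (fun w => w.1 0 1)); rewrite mxE. Qed.
Let vm i j : vanish_off_square (fun z => (w (vec2 z)).2 i j).
Proof. by apply: (@vanish_comp (fun w => w.2 i j)); rewrite mxE. Qed.
Let vS i : vanish_off_square ((fun z => (w (vec2 z)).2 i i) + (q \o vec2)).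
Proof.
move=> s t st; have := vm i i st; have := vanish_q st.
rewrite -[X in _ -> _ -> X = _]/((w (vec2 (s, t))).2 i i + q (vec2 (s, t))) /=.
by move=> -> ->; exact: addr0.
Qed.

Let div_S0 : ((partial 0 (fun t => (w t).2 0 0) \o vec2) + (partial 0 q \o vec2)) +
  (partial 1 (fun t => (w t).2 0 1) \o vec2) = 0.
Proof. by rewrite addrAC; exact: div_S. Qed.

Let div_S1 : (partial 0 (fun t => (w t).2 1 0) \o vec2) +
  ((partial 1 (fun t => (w t).2 1 1) \o vec2) + (partial 1 q \o vec2)) = 0.
Proof. by rewrite addrA; exact: div_S. Qed.

Let phase z : (w z).2 1 0 = (w z).2 0 1 /\ (w z).2 1 1 = - (w z).2 0 0.
Proof. by apply/phase_space2; have [] := wq. Qed.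

Lemma subsolution_continuous :
  [/\ continuous x, continuous y, continuous a, continuous b & continuous p].
Proof.
split; [by case: Cx|by case: Cy|by case: (C1m 0 0)|by case: CS01|by case: C1q].
Qed.

Let div10 : (cst 0 : R * R -> R) + cst 0 = 0.
Proof. by apply/funext => z; exact: addr0. Qed.

(** The field v is paired with the constant field (-1, 0). *)
Lemma integral_subsolution_v2 : I y = 0.
Proof.
rewrite -[RHS](integral_cross_eq0 Cx Cy div_v vx vy
  (C1_cst (-1)) (C1_cst 0) div10).
by apply: eq_Rintegral => z _; rewrite /= mulr0 mulrN1 opprK add0r.
Qed.

(** Pairing the rows of S with constant fields shows that a + q and q - a have zero mean; a is half
    their difference. *)
Lemma integral_subsolution_u11 : I a = 0.
Proof.
have [_ _ ca _ cp] := subsolution_continuous.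
have h1 : I (fun z => a z + p z) = 0.
  rewrite -[RHS](integral_cross_eq0 CS00 CS01 div_S0 (vS 0) (vm 0 1)
    (C1_cst 0) (C1_cst 1) div10).
  by apply: eq_Rintegral => z _; rewrite /= mulr0 mulr1 subr0.
have h2 : I (fun z => p z - a z) = 0.
  rewrite -[RHS](integral_cross_eq0 CS10 CS11 div_S1 (vm 1 0) (vS 1)
    (C1_cst (-1)) (C1_cst 0) div10).
  apply: eq_Rintegral => z _; rewrite /= mulr0 mulrN1 opprK add0r.
  by rewrite -[RHS]/((w (vec2 z)).2 1 1 + p z) (phase _).2 addrC.
have cap : continuous (fun z => a z + p z).
  by move=> z; apply: cvgD; [exact: ca|exact: cp].
have cpa : continuous (fun z => p z - a z).
  by move=> z; apply: cvgB; [exact: cp|exact: ca].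
have mI := @measurable_rect R 0 1 0 1.
suff : 2 * I a = 0 by move/eqP; rewrite mulf_eq0 pnatr_eq0 => /eqP.
rewrite -[RHS]subr0 -[X in _ = X - _]h1 -[X in _ = _ - X]h2;
  rewrite -RintegralB -?RintegralZl//; try exact: continuous_integrable_rect.
by apply: eq_Rintegral => z _; ring.
Qed.

(** The null Lagrangian of v and the first row of S. *)
Lemma integral_subsolution_vS : I (fun z => x z * b z - y z * (a z + p z)) = 0.
Proof.
rewrite -[RHS](integral_cross_eq0 Cx Cy div_v vx vy CS00 CS01 div_S0).
by apply: eq_Rintegral.
Qed.

(** The null Lagrangian of the two rows of S, that is, det S. *)
Lemma integral_subsolution_det :
  I (fun z => (a z + p z) * (p z - a z) - b z ^+ 2) = 0.
Proof.
rewrite -[RHS](integral_cross_eq0 CS00 CS01 div_S0 (vS 0) (vm 0 1)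
  CS10 CS11 div_S1).
apply: eq_Rintegral => z _.
rewrite -[RHS]/((a z + p z) * ((w (vec2 z)).2 1 1 + q (vec2 z)) -
   b z * (w (vec2 z)).2 1 0).
by rewrite (phase _).1 (phase _).2 /a /b /p; ring.
Qed.

End Subsolution.

(** * The hull and its interior *)

Section States.
Context {R : realType}.
Notation state := ('rV[R]_2 * 'M[R]_2)%type.

Lemma convex_setP (V : lmodType R) (A : set V) : convex_set A <->
  forall v w k, 0 <= k <= 1 -> A v -> A w -> A (k *: v + (1 - k) *: w).
Proof.
split=> [cA v w k /andP[k0 k1] Av Aw|h v w k].
  by have := cA v w (Itv01 k0 k1); rewrite !inE; apply.
by rewrite !inE => Av Aw; apply: h => //; apply/andP.
Qed.

Definition mk (x y a b : R) : state :=
  (vec2 (x, y), \matrix_(i, j) (if i == j then (if i == 0 then a else - a) else b)).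

Lemma mkE x y a b : ((mk x y a b).1 0 0 = x) * ((mk x y a b).1 0 1 = y) *
  ((mk x y a b).2 0 0 = a) * ((mk x y a b).2 0 1 = b) *
  ((mk x y a b).2 1 0 = b) * ((mk x y a b).2 1 1 = - a).
Proof. by rewrite !mxE. Qed.

Lemma ord2P (k : 'I_2) : k = 0 \/ k = 1.
Proof. by case: k => -[|[|//]] ?; [left|right]; exact/val_inj. Qed.

Lemma state_eqP (w w' : state) : w.1 0 0 = w'.1 0 0 -> w.1 0 1 = w'.1 0 1 ->
  w.2 0 0 = w'.2 0 0 -> w.2 0 1 = w'.2 0 1 -> w.2 1 0 = w'.2 1 0 ->
  w.2 1 1 = w'.2 1 1 -> w = w'.
Proof.
move: w w' => [v u] [v' u'] /= v0 v1 u00 u01 u10 u11; congr pair.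
  by apply/rowP => i; have [->|->] := ord2P i.
apply/matrixP => i j.
by have [->|->] := ord2P i; have [->|->] := ord2P j.
Qed.

Lemma phase_mk x y a b : phase_space (mk x y a b).
Proof. by apply/phase_space2; rewrite !mkE. Qed.

Lemma mk_phase w : phase_space w ->
  w = mk (w.1 0 0) (w.1 0 1) (w.2 0 0) (w.2 0 1).
Proof. by move=> /phase_space2[h1 h2]; apply: state_eqP; rewrite !mkE. Qed.

Lemma mk_comb k l x y a b x' y' a' b' :
  k *: mk x y a b + l *: mk x' y' a' b' =
  mk (k * x + l * x') (k * y + l * y') (k * a + l * a') (k * b + l * b').
Proof. by apply: state_eqP; rewrite !mxE//=; ring. Qed.

Lemma Kset_mk r x y a b :
  Kset r (mk x y a b) <-> [/\ x ^+ 2 + y ^+ 2 = r, a = x ^+ 2 - r / 2 & b = x * y].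
Proof.
split=> [[_ /matrixP h]|[xyr ea eb]].
  have := h 0 0; have := h 0 1; have := h 1 1.
  rewrite !mxE !big_ord1 !mxE/= => h11 h01 h00.
  by split; lra.
split; first exact: phase_mk.
have r2 : r / 2 = (x ^+ 2 + y ^+ 2) / 2 by rewrite xyr.
apply/matrixP => i j.
have [->|->] := ord2P i; have [->|->] := ord2P j;
  rewrite !mxE !big_ord1 !mxE/= ?ea ?eb; lra.
Qed.

(** For fixed e = (p, s) the function (v.e)^2 - <u e, e> is convex in (v, u) and equals (r / 2)
    |e|^2 on K_r, so its sublevel set is convex and contains K_r. *)
Lemma Uset_le r w : @Uset R 2 r w -> phase_space w /\
  forall p s : R, (p * w.1 0 0 + s * w.1 0 1) ^+ 2 -
    (p ^+ 2 * w.2 0 0 + 2 * p * s * w.2 0 1 - s ^+ 2 * w.2 0 0) <=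
    r / 2 * (p ^+ 2 + s ^+ 2).
Proof.
move=> Uw; have hw : convex_hull (Kset r) w by exact: interior_subset Uw.
apply: (hw [set v | phase_space v /\ forall p s : R,
  (p * v.1 0 0 + s * v.1 0 1) ^+ 2 -
    (p ^+ 2 * v.2 0 0 + 2 * p * s * v.2 0 1 - s ^+ 2 * v.2 0 0) <=
  r / 2 * (p ^+ 2 + s ^+ 2)]); split.
  apply/convex_setP => v v' k /andP[k0 k1] [pv hv] [pv' hv'].
  rewrite (mk_phase pv) (mk_phase pv') mk_comb; split; first exact: phase_mk.
  move=> p s; move: (hv p s) (hv' p s); rewrite !mkE.
  set x := v.1 0 0; set y := v.1 0 1; set x' := v'.1 0 0; set y' := v'.1 0 1.
  set a := v.2 0 0; set b := v.2 0 1; set a' := v'.2 0 0; set b' := v'.2 0 1.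
  move=> h h'.
  have e : (p * (k * x + (1 - k) * x') + s * (k * y + (1 - k) * y')) ^+ 2 =
    k * (p * x + s * y) ^+ 2 + (1 - k) * (p * x' + s * y') ^+ 2 -
    k * (1 - k) * ((p * x + s * y) - (p * x' + s * y')) ^+ 2 by ring.
  have q0 : 0 <= k * (1 - k) * ((p * x + s * y) - (p * x' + s * y')) ^+ 2.
    by rewrite mulr_ge0 ?sqr_ge0// mulr_ge0// subr_ge0.
  have := ler_wpM2l k0 h; have := @ler_wpM2l _ (1 - k) _ _ _ h'.
  rewrite subr_ge0 => /(_ k1); rewrite e; lra.
move=> v Kv; have pv : phase_space v by case: Kv.
split=> //; move: Kv; rewrite {1}(mk_phase pv) => /Kset_mk[h1 -> ->] p s.
rewrite -h1; lra.
Qed.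


(* Opposite points of K_r have the same u, so their midpoints (0, u) lie in A;
   averaging these with points of K_r gives (v, 0). *)
Lemma convex_ball_mk (eta : R) (A : set state) : 0 < eta -> convex_set A ->
  Kset (4 * eta ^+ 2) `<=` A ->
  forall x y a b, `|4 * x| <= eta -> `|4 * y| <= eta ->
    `|4 * a| <= 2 * eta ^+ 2 -> `|4 * b| <= 2 * eta ^+ 2 -> A (mk x y a b).
Proof.
move=> eta0 /convex_setP cA KA x y a b hx hy ha hb.
have mid x1 y1 a1 b1 x2 y2 a2 b2 : A (mk x1 y1 a1 b1) -> A (mk x2 y2 a2 b2) ->
    A (mk ((x1 + x2) / 2) ((y1 + y2) / 2) ((a1 + a2) / 2) ((b1 + b2) / 2)).
  move=> A1 A2; have h2 : 0 <= (2^-1 : R) <= 1 by apply/andP; split; lra.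
  by have := cA _ _ _ h2 A1 A2; rewrite mk_comb; congr (A (mk _ _ _ _)); field.
have mkP x1 y1 a1 b1 : x1 ^+ 2 + y1 ^+ 2 = 4 * eta ^+ 2 ->
    a1 = x1 ^+ 2 - 2 * eta ^+ 2 -> b1 = x1 * y1 -> A (mk x1 y1 a1 b1).
  by move=> h1 h2 h3; apply/KA/Kset_mk; split=> //; rewrite h2; field.
(* The diagonal points (q, q) and (q, -q) of the circle of radius 2 eta have a = 0 and b equal to 2
   eta^2 and -2 eta^2. *)
pose q := Num.sqrt 2 * eta.
have q2 : q ^+ 2 = 2 * eta ^+ 2 by rewrite exprMn sqr_sqrtr.
have pm x1 y1 a1 b1 : x1 ^+ 2 + y1 ^+ 2 = 4 * eta ^+ 2 ->
    a1 = x1 ^+ 2 - 2 * eta ^+ 2 -> b1 = x1 * y1 -> A (mk 0 0 a1 b1).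
  move=> h1 h2 h3; have A2 : A (mk (- x1) (- y1) a1 b1).
    by apply: mkP; rewrite ?sqrrN ?mulrNN.
  have := mid _ _ _ _ _ _ _ _ (mkP _ _ _ _ h1 h2 h3) A2.
  by congr (A (mk _ _ _ _)); field.
have aP : A (mk 0 0 (2 * eta ^+ 2) 0) by apply: (pm (2 * eta) 0); ring.
have aN : A (mk 0 0 (- (2 * eta ^+ 2)) 0) by apply: (pm 0 (2 * eta)); ring.
have bP : A (mk 0 0 0 (2 * eta ^+ 2)) by apply: (pm q q); lra.
have bN : A (mk 0 0 0 (- (2 * eta ^+ 2))) by apply: (pm q (- q)); lra.
have xP s : s ^+ 2 = 1 -> A (mk (s * eta) 0 0 0).
  move=> s1; have A2 : A (mk (s * (2 * eta)) 0 (2 * eta ^+ 2) 0).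
    by apply: mkP; rewrite ?exprMn ?s1; ring.
  have := mid _ _ _ _ _ _ _ _ aN A2.
  by congr (A (mk _ _ _ _)); field.
have yP s : s ^+ 2 = 1 -> A (mk 0 (s * eta) 0 0).
  move=> s1; have A2 : A (mk 0 (s * (2 * eta)) (- (2 * eta ^+ 2)) 0).
    by apply: mkP; rewrite ?exprMn ?s1; ring.
  have := mid _ _ _ _ _ _ _ _ aP A2.
  by congr (A (mk _ _ _ _)); field.
(* A multiple of a point by a factor in [-1, 1] is a convex combination of the point and its
   opposite. *)
have seg x1 y1 a1 b1 k c : 0 < c -> `|k| <= c -> A (mk x1 y1 a1 b1) ->
    A (mk (- x1) (- y1) (- a1) (- b1)) ->
    A (mk (k / c * x1) (k / c * y1) (k / c * a1) (k / c * b1)).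
  rewrite ler_norml => c0 /andP[k1 k2] A1 A2.
  have k01 : 0 <= (1 + k / c) / 2 <= 1.
    have : -1 <= k / c by rewrite ler_pdivlMr// mulN1r.
    have : k / c <= 1 by rewrite ler_pdivrMr// mul1r.
    by move=> ? ?; apply/andP; split; lra.
  have := cA _ _ _ k01 A1 A2; rewrite mk_comb.
  by congr (A (mk _ _ _ _)); field; exact: lt0r_neq0.
have e20 : 0 < 2 * eta ^+ 2 by rewrite mulr_gt0// exprn_gt0.
have one_sqr : 1 ^+ 2 = 1 :> R by exact: expr1n.
have mone_sqr : (-1) ^+ 2 = 1 :> R by rewrite sqrrN expr1n.
have xx : A (mk (4 * x) 0 0 0).
  have xN := xP _ mone_sqr; rewrite mulNr -oppr0 in xN.
  have := seg _ _ _ _ _ _ eta0 hx (xP _ one_sqr) xN.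
  by congr (A (mk _ _ _ _)); field; exact: lt0r_neq0.
have yy : A (mk 0 (4 * y) 0 0).
  have yN := yP _ mone_sqr; rewrite mulNr -oppr0 in yN.
  have := seg _ _ _ _ _ _ eta0 hy (yP _ one_sqr) yN.
  by congr (A (mk _ _ _ _)); field; exact: lt0r_neq0.
have aa : A (mk 0 0 (4 * a) 0).
  have := seg _ _ _ _ _ _ e20 ha aP ltac:(by rewrite oppr0).
  by congr (A (mk _ _ _ _)); field; exact: lt0r_neq0.
have bb : A (mk 0 0 0 (4 * b)).
  have := seg _ _ _ _ _ _ e20 hb bP ltac:(by rewrite oppr0).
  by congr (A (mk _ _ _ _)); field; exact: lt0r_neq0.
(* Averaging twice divides each coordinate by 4, whence the factors 4 in the hypotheses. *)
have := mid _ _ _ _ _ _ _ _ (mid _ _ _ _ _ _ _ _ xx yy) (mid _ _ _ _ _ _ _ _ aa bb).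
by congr (A (mk _ _ _ _)); field.
Qed.

(** Let w1 be the boundary point. A state w near t w1 equals t w1 + (1 - t) z with z = (w - t w1) /
    (1 - t), and z is small enough for [convex_ball_mk]. *)
Lemma Uset_segment (eta t : R) : 0 < eta -> 0 <= t < 1 ->
  @Uset R 2 (4 * eta ^+ 2) (mk 0 (t * eta) (t * eta ^+ 2) 0).
Proof.
move=> eta0 /andP[t0 t1].
set w0 := mk _ _ _ _.
rewrite /Uset /interior/=.
suff : within phase_space (nbhs w0) (convex_hull (Kset (4 * eta ^+ 2))).
  by rewrite nbhs_subspace_in//; exact: phase_mk.
rewrite /within/=.
have t10 : 0 < 1 - t by rewrite subr_gt0.
pose e1 := (1 - t) * eta / 4; pose e2 := (1 - t) * (2 * eta ^+ 2) / 4.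
have e10 : 0 < e1 by rewrite divr_gt0// mulr_gt0.
have e20 : 0 < e2 by rewrite divr_gt0// !mulr_gt0// exprn_gt0.
have cx i := @vcoord_continuous R i w0.
have cu i j := @mcoord_continuous R i j w0.
near=> w => pw A [cA KA].
have hx : `|w0.1 0 0 - w.1 0 0| <= e1.
  by near: w; exact: (@cvgr_dist_le _ _ _ _ _ _ _ (cx 0)).
have hy : `|w0.1 0 1 - w.1 0 1| <= e1.
  by near: w; exact: (@cvgr_dist_le _ _ _ _ _ _ _ (cx 1)).
have ha : `|w0.2 0 0 - w.2 0 0| <= e2.
  by near: w; exact: (@cvgr_dist_le _ _ _ _ _ _ _ (cu 0 0)).
have hb : `|w0.2 0 1 - w.2 0 1| <= e2.
  by near: w; exact: (@cvgr_dist_le _ _ _ _ _ _ _ (cu 0 1)).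
move: hx hy ha hb; rewrite !mkE (mk_phase pw) !mkE.
move: (w.1 0 0) (w.1 0 1) (w.2 0 0) (w.2 0 1) => x y a b hx hy ha hb.
have sc k e : `|k| <= (1 - t) * e / 4 -> `|4 * (k / (1 - t))| <= e.
  move=> h; rewrite mulrA normrM normfV (gtr0_norm t10) ler_pdivrMr//.
  by rewrite normrM gtr0_norm//; lra.
move/convex_setP : (cA) => cA'.
(* The boundary point is the midpoint of the two points of K_r with velocities (q, eta) and (-q,
   eta). *)
have Ab : A (mk 0 eta (eta ^+ 2) 0).
  pose q := Num.sqrt 3 * eta.
  have q2 : q ^+ 2 = 3 * eta ^+ 2 by rewrite exprMn sqr_sqrtr.
  have A1 : A (mk q eta (eta ^+ 2) (q * eta)).
    by apply/KA/Kset_mk; split => //; lra.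
  have A2 : A (mk (- q) eta (eta ^+ 2) (- (q * eta))).
    by apply/KA/Kset_mk; split; lra.
  have h2 : 0 <= (2^-1 : R) <= 1 by apply/andP; split; lra.
  by have := cA' _ _ _ h2 A1 A2; rewrite mk_comb; congr (A (mk _ _ _ _)); field.
rewrite distrC in hx; rewrite distrC in hy.
rewrite distrC in ha; rewrite distrC in hb.
have t01 : 0 <= t <= 1 by rewrite t0 ltW.
have := cA' _ _ _ t01 Ab
  (convex_ball_mk eta0 cA KA (sc _ _ hx) (sc _ _ hy) (sc _ _ ha) (sc _ _ hb)).
by rewrite mk_comb; congr (A (mk _ _ _ _)); field; exact: lt0r_neq0.
Unshelve. all: by end_near. Qed.

Lemma enorm_sqr (v : 'rV[R]_2) : enorm v ^+ 2 = v 0 0 ^+ 2 + v 0 1 ^+ 2.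
Proof.
by rewrite /enorm sqr_sqrtr sum_ord2// addr_ge0// sqr_ge0.
Qed.

(** The velocities suffice: those of K_r lie on the circle of radius 2 eta, at distance at least (2
    - t) eta from (0, t eta). *)
Lemma dist_Kset_segment (eta t : R) : 0 < eta -> 0 <= t <= 1 ->
  eta <= dist (mk 0 (t * eta) (t * eta ^+ 2) 0) (Kset (4 * eta ^+ 2)).
Proof.
move=> eta0 /andP[t0 t1]; apply: lb_le_inf.
  exists (pnorm (mk 0 (t * eta) (t * eta ^+ 2) 0 -
    mk (2 * eta) 0 (2 * eta ^+ 2) 0)).
  by eexists; last reflexivity; apply/Kset_mk; split; field.
move=> _ [v Kv <-]; have pv : phase_space v by case: Kv.
move: Kv; rewrite (mk_phase pv); set x := v.1 0 0; set y := v.1 0 1.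
move=> /Kset_mk[xy _ _].
rewrite /pnorm -[leLHS]gtr0_norm// -sqrtr_sqr; apply: ler_wsqrtr.
rewrite -[leLHS]addr0 lerD ?sqr_ge0//.
rewrite enorm_sqr !mxE/=.
have y2 : y <= 2 * eta by have := sqr_ge0 x; nra.
have : 0 <= (2 * eta - y) * (t * eta).
  by rewrite mulr_ge0 ?subr_ge0// mulr_ge0// ltW.
(* This quantity is ((2 - t)^2 - 1) eta^2. *)
have : 0 <= (1 - t) * (3 - t) * eta ^+ 2.
  by rewrite mulr_ge0 ?sqr_ge0// mulr_ge0//; lra.
lra.
Qed.

(** In the plane a symmetric trace-free u satisfies u^T u = (a^2 + b^2) Id, so it multiplies all
    lengths by [rho], which is its operator norm. *)
Lemma pnorm_sqr (w : state) : phase_space w ->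
  pnorm w ^+ 2 = w.1 0 0 ^+ 2 + w.1 0 1 ^+ 2 + w.2 0 0 ^+ 2 + w.2 0 1 ^+ 2.
Proof.
move=> /phase_space2[u10 u11].
rewrite /pnorm sqr_sqrtr ?addr_ge0 ?sqr_ge0// enorm_sqr -[RHS]addrA.
congr (_ + _).
set rho2 := w.2 0 0 ^+ 2 + _; pose rho := Num.sqrt rho2.
have r0 : 0 <= rho2 by rewrite addr_ge0// sqr_ge0.
have uE (z : 'rV[R]_2) : enorm (z *m (w.2)^T) = rho * enorm z.
  rewrite /rho /enorm -sqrtrM// !sum_ord2 !mxE !sum_ord2 !mxE u10 u11 /rho2.
  by congr Num.sqrt; ring.
suff -> : opnorm w.2 = rho by rewrite sqr_sqrtr.
have ub : ubound [set enorm (z *m (w.2)^T) | z in [set z | enorm z <= 1]] rho.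
  by move=> _ [z /= z1 <-]; rewrite uE ler_piMr// sqrtr_ge0.
have e1 : enorm (delta_mx 0 0 : 'rV[R]_2) = 1.
  by rewrite /enorm sum_ord2 !mxE/= expr1n expr0n addr0 sqrtr1.
apply/eqP; rewrite eq_le; apply/andP; split.
  apply: ge_sup => //; eexists; exists (delta_mx 0 0); last reflexivity.
  by rewrite /= e1.
apply: ub_le_sup; first by exists rho.
by exists (delta_mx 0 0); rewrite /= ?uE ?e1 ?mulr1.
Qed.

End States.

(** * Coercivity *)

Section Coercivity.
Context {R : realType}.

(* In the first two brackets, x b - y (a + q) and det (u + q Id) have zero mean;
   the third one is y^2 plus the gap of the inequality for (p, s) = (0, 1). *)
Lemma coercive_estimate (eta : R) : 0 < eta ->
  exists c M : R, 0 < M /\ forall l, 0 < l -> exists2 K, 0 <= K &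
  forall t x y a b q delta, 1 / 2 <= t <= 1 ->
  delta = eta ^+ 2 * (1 - t) * (2 + t) ->
  (forall p s : R, (p * x + s * (t * eta + y)) ^+ 2 -
    (p ^+ 2 * (t * eta ^+ 2 + a) + 2 * p * s * b - s ^+ 2 * (t * eta ^+ 2 + a))
    <= 2 * eta ^+ 2 * (p ^+ 2 + s ^+ 2)) ->
  x ^+ 2 + y ^+ 2 + a ^+ 2 + b ^+ 2 <=
    c * (x * b - y * (a + q)) + c * l * ((a + q) * (q - a) - b ^+ 2) +
    K * (delta - 2 * t * eta * y - a) + M * l + 3 * eta ^+ 2 * delta.
Proof.
move=> eta0.
have e2 : 0 < eta ^+ 2 by rewrite exprn_gt0.
have e3 : 0 < eta ^+ 3 by rewrite exprn_gt0.
have e4 : 0 < eta ^+ 4 by rewrite exprn_gt0.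
(* The bound [hb] on b^2 costs 8 eta^2 x^2; this [c] turns a bound on eta x^2 / 2 into one on (1 + 8
   eta^2) x^2. *)
have [c c0 ceta] : exists2 c, 0 < c & c * eta = 2 * (1 + 8 * eta ^+ 2).
  exists ((1 + 8 * eta ^+ 2) * (2 / eta)); last by field; exact: lt0r_neq0.
  by rewrite mulr_gt0 ?divr_gt0//; lra.
exists c, (c * (22 * eta ^+ 4 + 4 * eta ^+ 2) + 3 * eta ^+ 3); split.
  by rewrite addr_gt0 ?mulr_gt0//; lra.
move=> l l0; have L0 : 0 < l^-1 by rewrite invr_gt0.
have Ll : l^-1 * l = 1 by rewrite mulVf// lt0r_neq0.
move: (l^-1) L0 Ll => L L0 Ll.
(* The coefficients of [P] in [hX], in the bounds for y^2 and b^2, and in [ha]; they depend on [l]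
   through L = 1 / l. *)
exists (c * (L / 2 * (1 + 8 * eta ^+ 2)) + (1 + 8 * eta ^+ 2) + 3 * eta ^+ 2 +
    3 * eta ^+ 3 * L).
  have : 0 < L / 2 * (1 + 8 * eta ^+ 2) by rewrite mulr_gt0//; lra.
  move=> /(mulr_gt0 c0) h; have : 0 < eta ^+ 3 * L by rewrite mulr_gt0.
  lra.
move=> t x y a b q delta /andP[t0 t1] deltaE H.
have delta0 : 0 <= delta.
  by rewrite deltaE !mulr_ge0 ?(ltW e2)//; lra.
(* [H] says that the form k p^2 + 2 E p s + g s^2 is nonnegative, where k = 2 eta^2 - x^2 + U. The
   value of [g] at the unperturbed state is [delta], and [P] is affine in the perturbation. *)
pose Y := t * eta + y; pose U := t * eta ^+ 2 + a; pose E := b - x * Y.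
pose g := 2 * eta ^+ 2 - Y ^+ 2 - U; pose P := delta - 2 * t * eta * y - a.
have PE : P = y ^+ 2 + g by rewrite /P /g deltaE /Y /U; ring.
have g0 : 0 <= g by have := H 0 1; rewrite -/Y -/U /g; lra.
have k0 : 0 <= 2 * eta ^+ 2 - x ^+ 2 + U by have := H 1 0; rewrite -/Y -/U; lra.
have bl : - (2 * eta ^+ 2) <= b.
  by have := H 1 1; have := sqr_ge0 (x + Y); rewrite -/Y -/U; lra.
have bu : b <= 2 * eta ^+ 2.
  by have := H 1 (-1); have := sqr_ge0 (x - Y); rewrite -/Y -/U; lra.
have x2 := sqr_ge0 x; have y2 := sqr_ge0 y; have Y2 := sqr_ge0 Y.
(* The discriminant of the quadratic form in (p, s), whose diagonal entries
   are nonnegative with sum at most 4 eta^2. *)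
have Eg : E ^+ 2 <= 4 * eta ^+ 2 * g.
  have := H (- E) (4 * eta ^+ 2); rewrite -/Y -/U => h.
  have kE : (2 * eta ^+ 2 - x ^+ 2 + U) * E ^+ 2 <= 4 * eta ^+ 2 * E ^+ 2.
    by rewrite ler_wpM2r ?sqr_ge0//; move: g0; rewrite /g; lra.
  rewrite -(ler_pM2l (x := 4 * eta ^+ 2)); last by lra.
  suff : 0 <= (2 * eta ^+ 2 - x ^+ 2 + U) * E ^+ 2 + (4 * eta ^+ 2) ^+ 2 * g -
     2 * (4 * eta ^+ 2) * E ^+ 2 by lra.
  by move: h; rewrite -subr_ge0; congr (0 <= _); rewrite /g /E; ring.
have EP : E ^+ 2 <= 4 * eta ^+ 2 * P.
  by apply: (le_trans Eg); rewrite ler_wpM2l//; lra.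
have P0 : 0 <= P by lra.
have x4 : x ^+ 2 <= 4 * eta ^+ 2 by move: g0; rewrite /g; lra.
have Y4 : Y ^+ 2 <= 4 * eta ^+ 2 by move: g0; rewrite /g; lra.
have te2 : 0 <= t * eta ^+ 2 <= eta ^+ 2.
  by rewrite mulr_ge0 ?(ltW e2)//= ?ger_pMl//; lra.
have al : - (3 * eta ^+ 2) <= a by move: te2 => /andP[]; move: k0; rewrite /U; lra.
have au : a <= 3 * eta ^+ 2 by move: te2 => /andP[]; move: g0; rewrite /g /U; lra.
(* Weighted Young inequality: the quantities controlled by [P] take the large weight L, the others
   the small weight l. *)
have amgm u v : 2 * (u * v) <= L * u ^+ 2 + l * v ^+ 2.
  have : 0 <= L * (u - l * v) ^+ 2 by rewrite mulr_ge0 ?sqr_ge0// ltW.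
  have -> : L * (u - l * v) ^+ 2 =
    L * u ^+ 2 - 2 * (L * l) * (u * v) + (L * l) * (l * v ^+ 2) by ring.
  by rewrite Ll; lra.
have LP u : u ^+ 2 <= P -> L * u ^+ 2 <= L * P by move=> h; rewrite ler_wpM2l// ltW.
have Ly : L * y ^+ 2 <= L * P by apply: LP; lra.
have LP0 : 0 <= L * P by rewrite mulr_ge0// ltW.
have LE : L * E ^+ 2 <= 4 * eta ^+ 2 * (L * P).
  by have := ler_wpM2l (ltW L0) EP; lra.
have a2 : a ^+ 2 <= 9 * eta ^+ 4 by nra.
have b2 : b ^+ 2 <= 4 * eta ^+ 4 by nra.
have yn : 2 * - y <= L * P + l by have := amgm (- y) 1; rewrite sqrrN; lra.
have yp : 2 * y <= L * P + l by have := amgm y 1; lra.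
have LPl0 : 0 <= L * P + l by lra.
have h3 : - (x ^+ 2 * y) <= 2 * eta ^+ 2 * (L * P + l).
  have : x ^+ 2 * (2 * - y) <= x ^+ 2 * (L * P + l) by rewrite ler_wpM2l.
  have : x ^+ 2 * (L * P + l) <= 4 * eta ^+ 2 * (L * P + l) by rewrite ler_wpM2r.
  lra.
have h4 : - (x * E) <= 2 * eta ^+ 2 * (L * P) + 2 * eta ^+ 2 * l.
  have := amgm E (- x); rewrite sqrrN.
  have : l * x ^+ 2 <= l * (4 * eta ^+ 2) by rewrite ler_wpM2l// ltW.
  lra.
pose N1 := x * b - y * (a + q); pose N2 := (a + q) * (q - a) - b ^+ 2.
(* The pressure has no pointwise bound; q^2 is traded for N2 + a^2 + b^2, where N2 will integrate to
   zero. *)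
have h2 : y * (a + q) <= L * P / 2 + l * N2 + 22 * eta ^+ 4 * l.
  have := amgm y (a + q).
  have : l * (a + q) ^+ 2 <= l * (2 * N2 + 44 * eta ^+ 4).
    rewrite ler_wpM2l ?(ltW l0)// /N2.
    by have := sqr_ge0 (a - q); lra.
  lra.
(* The coercive term: x b = x^2 Y + x E, and x^2 Y contains t eta x^2. *)
have h1 : t * eta * x ^+ 2 = N1 + y * (a + q) - x ^+ 2 * y - x * E.
  by rewrite /N1 /E /Y; ring.
have hx : eta * x ^+ 2 / 2 <= t * eta * x ^+ 2.
  have : 0 <= (t - 1 / 2) * (eta * x ^+ 2).
    by rewrite mulr_ge0 ?subr_ge0 ?(mulr_ge0 (ltW eta0)).
  lra.
have hX : (1 + 8 * eta ^+ 2) * x ^+ 2 <=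
   c * (N1 + l * N2 + L * P / 2 * (1 + 8 * eta ^+ 2) +
     l * (22 * eta ^+ 4 + 4 * eta ^+ 2)).
  have -> : (1 + 8 * eta ^+ 2) * x ^+ 2 = c * (eta * x ^+ 2 / 2).
    by rewrite !mulrA ceta; field.
  by rewrite ler_wpM2l ?(ltW c0)//; lra.
(* One factor of a^2 is bounded by 3 eta^2, the other through the affine relation between a, y and
   P. *)
have ha : a ^+ 2 <= 3 * eta ^+ 2 * (delta + P + eta * (L * P + l)).
  have ty u : 2 * u <= L * P + l -> t * eta * (2 * u) <= eta * (L * P + l).
    move=> hu; have : t * eta * (2 * u) <= t * eta * (L * P + l).
      by rewrite ler_wpM2l// mulr_ge0// ?(ltW eta0)//; lra.
    move=> /le_trans; apply; rewrite ler_wpM2r// ger_pMl//.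
  have := ty _ yn; have := ty _ yp => hp hn.
  have aE : a = delta - 2 * t * eta * y - P by rewrite /P; ring.
  have a1 : a <= delta + P + eta * (L * P + l) by lra.
  have a1' : - a <= delta + P + eta * (L * P + l) by lra.
  have [a0|/ltW a0] := leP 0 a; first by rewrite expr2 ler_pM.
  by rewrite -sqrrN expr2 ler_pM ?oppr_ge0// lerNl.
have hb : b ^+ 2 <= 8 * eta ^+ 2 * P + 8 * eta ^+ 2 * x ^+ 2.
  have : x ^+ 2 * Y ^+ 2 <= x ^+ 2 * (4 * eta ^+ 2) by rewrite ler_wpM2l.
  have : b ^+ 2 <= 2 * E ^+ 2 + 2 * (x ^+ 2 * Y ^+ 2).
    by rewrite /E; have := sqr_ge0 (b - 2 * (x * Y)); lra.
  lra.
rewrite -/N1 -/N2 -/P.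
have : y ^+ 2 <= P by lra.
lra.
Qed.

End Coercivity.

(** * Smallness of admissible perturbations in mean square *)

Section Final.
Context {R : realType}.
Notation mu := (@lebesgue_measure R).
Notation mu2 := (mu \x mu)%E.
Notation state := ('rV[R]_2 * 'M[R]_2)%type.
Notation I f := (\int[mu2]_(z in rect 0 1 0 1) f z).

Lemma RintegralD_scale (f g : R * R -> R) k : continuous f -> continuous g ->
  I (fun z => f z + k * g z) = I f + k * I g.
Proof.
move=> cf cg; rewrite RintegralD ?RintegralZl//; try exact: measurable_rect;
  try exact: continuous_integrable_rect.
apply: (@continuous_integrable_rect R (fun z => k * g z)) => z.
by apply: cvgM; [exact: cvg_cst|exact: cg].
Qed.

Lemma continuousD_scale (f g : R * R -> R) k : continuous f -> continuous g ->
  continuous (fun z => f z + k * g z).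
Proof.
move=> cf cg z; apply: cvgD; first exact: cf.
by apply: cvgM; [exact: cvg_cst|exact: cg].
Qed.

Lemma Rintegral_unit_square_cst (k : R) : I (fun=> k) = k.
Proof.
rewrite Rintegral_cst; last exact: measurable_rect.
rewrite [X in _ * fine X](_ : _ = 1%E) ?mulr1//.
transitivity (mu `[0%R, 1%R] * mu `[0%R, 1%R])%E; first exact: product_measure1E.
by rewrite !lebesgue_measure_itv/= lte_fin ltr01 oppr0 adde0 mule1.
Qed.

(** The left side is an extended real integral over the open square, the right one a real integral
    over the closed square; [F] being nonnegative, the domain may be enlarged. *)
Lemma integral2_le (F G : R * R -> R) (f : 'rV[R]_2 -> R) :
  continuous F -> continuous G -> (forall z, f (vec2 z) = F z) ->
  (forall z, 0 <= F z <= G z) ->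
  (integral2 unit_cube f <= (I G)%:E)%E.
Proof.
move=> cF cG fF FG.
have mQ : measurable (vec2 @^-1` unit_cube : set (R * R)).
  have -> : vec2 @^-1` unit_cube = `]0, 1[ `*` `]0, 1[ :> set (R * R).
    apply/seteqP; split => -[s t] /=; first by move/unit_cube_vec2/andP.
    by move=> [s1 t1]; apply/unit_cube_vec2/andP.
  by apply: measurableX; exact: measurable_itv.
have mF D : measurable D -> measurable_fun D (fun z => (F z)%:E).
  move=> mD; apply/measurable_EFinP/(@measurable_funS _ _ _ _ setT) => //.
  exact: continuous_measurable_plane.
have mG D : measurable D -> measurable_fun D (fun z => (G z)%:E).
  move=> mD; apply/measurable_EFinP/(@measurable_funS _ _ _ _ setT) => //.
  exact: continuous_measurable_plane.
have F0 z : 0 <= F z by case/andP: (FG z).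
have mr := @measurable_rect R 0 1 0 1.
rewrite /integral2; under eq_integral do rewrite fF.
apply: (@le_trans _ _ (\int[mu2]_(z in rect 0 1 0 1) (F z)%:E)%E).
  apply: ge0_subset_integral => //; first exact: mF.
    by move=> z _; rewrite lee_fin.
  move=> [s t] /unit_cube_vec2/andP[/andP[? ?] /andP[? ?]].
  by split; rewrite /= in_itv/=; apply/andP; split; exact: ltW.
rewrite /Rintegral fineK; last first.
  by apply: integrable_fin_num => //; exact: continuous_integrable_rect.
apply: ge0_le_integral => //.
- by move=> z _; rewrite lee_fin.
- exact: mF.
- exact: mG.
- by move=> z _; rewrite lee_fin; case/andP: (FG z).
Qed.

(** Order of choices: [l] makes M l = e / 4, this fixes [K], then t is so close to 1 that (K + 3
    eta^2) delta <= e / 4. Only these two terms survive integration. *)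
Lemma small_perturbations (eta e : R) : 0 < eta -> 0 < e ->
  exists2 wbar : state,
    Uset (4 * eta ^+ 2) wbar /\ eta <= dist wbar (Kset (4 * eta ^+ 2)) &
  forall w q, subsolution w q -> Cc_infty unit_cube q ->
    (forall x, unit_cube x -> Uset (4 * eta ^+ 2) (wbar + w x)) ->
    (integral2 unit_cube (fun x => (pnorm (w x) ^+ 2)%R) < e%:E)%E.
Proof.
move=> eta0 e0; have [c [M [M0 est]]] := coercive_estimate eta0.
have e20 : 0 < eta ^+ 2 by rewrite exprn_gt0.
pose l := e / (4 * M).
have l0 : 0 < l by rewrite divr_gt0// mulr_gt0.
have Ml : M * l = e / 4 by rewrite /l; field; exact: lt0r_neq0.
have [K K0 {}est] := est _ l0.
(* As delta <= 3 eta^2 h, the product (K + 3 eta^2) delta is at most h D / 4; the 1 / 2 in [h]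
   ensures t >= 1 / 2. *)
pose D := 12 * eta ^+ 2 * (K + 3 * eta ^+ 2).
have D0 : 0 < D by rewrite !mulr_gt0//; lra.
pose h := Num.min (1 / 2) (e / D).
have h0 : 0 < h by rewrite lt_min divr_gt0//= divr_gt0.
have h1 : h <= 1 / 2 by rewrite ge_min lexx.
have hD : h * D <= e by rewrite -ler_pdivlMr// ge_min lexx orbT.
pose t := 1 - h; pose delta := eta ^+ 2 * (1 - t) * (2 + t).
have dh : (K + 3 * eta ^+ 2) * delta <= e / 4.
  have : delta <= 3 * eta ^+ 2 * h.
    have : 0 <= eta ^+ 2 * (h * h) by rewrite !mulr_ge0 ?ltW.
    by rewrite /delta /t subKr; lra.
  have Kp : 0 <= K + 3 * eta ^+ 2 by lra.
  by move=> /(ler_wpM2l Kp); move: hD; rewrite /D; lra.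
have t01 : 0 <= t < 1 by rewrite /t; apply/andP; split; lra.
set wbar := mk 0 (t * eta) (t * eta ^+ 2) 0.
have Uwbar : Uset (4 * eta ^+ 2) wbar by exact: Uset_segment.
exists wbar.
  split => //; apply: dist_Kset_segment => //.
  by move: t01 => /andP[-> /ltW].
move=> w q wq cq Uw.
have [cx cy ca cb cp] := subsolution_continuous wq cq.
have Iy := integral_subsolution_v2 wq.
have Ia := integral_subsolution_u11 wq cq.
have Iv := integral_subsolution_vS wq cq.
have Id := integral_subsolution_det wq cq.
move: cx cy ca cb cp Iy Ia Iv Id.
set x := fun z => (w (vec2 z)).1 0 0; set y := fun z => (w (vec2 z)).1 0 1.
set a := fun z => (w (vec2 z)).2 0 0; set b := fun z => (w (vec2 z)).2 0 1.
set p := fun z => q (vec2 z).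
move=> cx cy ca cb cp Iy Ia Iv Id.
pose N1 z := x z * b z - y z * (a z + p z).
pose N2 z := (a z + p z) * (p z - a z) - b z ^+ 2.
have sqc (f : R * R -> R) : continuous f -> continuous (fun z => f z ^+ 2).
  move=> cf z; apply: (@continuous_comp _ _ _ f (fun s => s ^+ 2)).
    exact: cf.
  exact: exprn_continuous.
have cN1 : continuous N1.
  move=> z; apply: cvgB; first by apply: cvgM; [exact: cx|exact: cb].
  by apply: cvgM; [exact: cy|apply: cvgD; [exact: ca|exact: cp]].
have cN2 : continuous N2.
  move=> z; apply: cvgB; last exact: sqc.
  by apply: cvgM; [apply: cvgD|apply: cvgB]; try exact: ca; exact: cp.
pose k0 := (K + 3 * eta ^+ 2) * delta + M * l.
(* The right-hand side of the pointwise estimate, as a constant plus multiples of four functions of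
   zero mean. *)
pose G z := k0 + c * N1 z + (c * l) * N2 z +
  (- (K * (2 * t * eta))) * y z + (- K) * a z.
pose F z := x z ^+ 2 + y z ^+ 2 + a z ^+ 2 + b z ^+ 2.
have c1 := continuousD_scale (k := c) (@cst_continuous _ _ (k0 : R)) cN1.
have c2 := continuousD_scale (k := (c * l)) c1 cN2.
have c3 := continuousD_scale (k := (- (K * (2 * t * eta)))) c2 cy.
have cG : continuous G by exact: (continuousD_scale (k := (- K)) c3 ca).
have IG : I G = k0.
  rewrite /G RintegralD_scale// RintegralD_scale// RintegralD_scale//.
  rewrite RintegralD_scale//; last exact: cst_continuous.
  by rewrite Iy Ia Iv Id !mulr0 !addr0 Rintegral_unit_square_cst.
have cF : continuous F.
  by move=> z; do !apply: cvgD; exact: sqc.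
have pw z : phase_space (w z) by case: wq.
apply: (@le_lt_trans _ _ (I G)%:E); last first.
  by rewrite lte_fin IG /k0 Ml; lra.
apply: (integral2_le cF cG) => z; first by rewrite pnorm_sqr.
apply/andP; split; first by rewrite !addr_ge0// sqr_ge0.
(* Off the open cube the perturbation is zero, so the estimate holds at every point, as
   [integral2_le] requires. *)
have Uz : Uset (4 * eta ^+ 2) (wbar + w (vec2 z)).
  have [/Uw//|Qz] := pselect (unit_cube (vec2 z)).
  by rewrite (subsolution_vanish wq Qz) addr0.
have [_ hz] := Uset_le Uz.
have thalf : 1 / 2 <= t <= 1 by rewrite /t; apply/andP; split; lra.
have := est t (x z) (y z) (a z) (b z) (p z) delta thalf erefl.
rewrite /F /G /k0 -/(N1 z) -/(N2 z) => /(_ _)/le_trans; apply; last by lra.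
move=> s s'; have := hz s s'.
rewrite /wbar (mk_phase (pw _)) -[mk 0 _ _ _]scale1r -[mk (_ _ _) _ _ _]scale1r.
rewrite mk_comb !mkE !mul1r !add0r.
suff -> : 4 * eta ^+ 2 / 2 = 2 * eta ^+ 2 by [].
by field.
Qed.

End Final.

Theorem theorem17 (R : realType) (r : R) (hr : 0 < r) :
  ~ perturbation_property r (@Uset R 2 r).
Proof.
move=> [Phi [_ Phi_incr Phi0 pert]].
pose eta := Num.sqrt r / 2.
have eta0 : 0 < eta by rewrite divr_gt0// sqrtr_gt0.
have rE : r = 4 * eta ^+ 2.
  by rewrite /eta expr_div_n sqr_sqrtr ?ltW//; field.
have in0 s : 0 <= s -> s \in `[0, +oo[ by rewrite in_itv/= andbT.
have Phieta : 0 < Phi eta.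
  by rewrite -Phi0; apply: Phi_incr => //; apply: in0 => //; exact: ltW.
(* The tolerance is [Phi eta]: property (P) would force a mean square of at least Phi (dist wbar
   K_r) >= Phi eta. *)
have [wbar [Uwbar dwbar] small] := small_perturbations eta0 Phieta.
rewrite rE in pert.
have [w [q [wq cq Uw]]] := pert _ Uwbar.
apply/negP; rewrite -ltNge; apply: (lt_le_trans (small _ _ wq cq Uw)).
rewrite lee_fin; move: dwbar; rewrite le_eqVlt => /predU1P[<-//|].
move=> d; apply/ltW/Phi_incr => //; apply: in0; first exact: ltW.
by rewrite ltW// (lt_trans eta0).
Qed.
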